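(* Let $k>0$ be an integer. Let $[\cdot,\cdot]$ be an indefinite scalar product on $\mathbb{C}^n$, given by $[x,y]=(Hx,y)$ with $H$ a nonsingular Hermitian operator, such that the space has rank $k$, and let $N$ be an indecomposable $H$-normal operator on $\mathbb{C}^n$. Then one of the following holds: (A) $N$ has exactly one eigenvalue and $2k\le n\le 4k$; (B) $N$ has exactly two distinct eigenvalues and $n=2k$. Moreover, these bounds are strict (i.e. attained) for every $k$. That is, for every integer $k>0$: - for $n=2k$ and also for $n=4k$, there exist a nonsingular Hermitian $H$ on $\mathbb{C}^n$ for which the space has rank $k$ and an indecomposable $H$-normal operator $N$ on $\mathbb{C}^n$ having exactly one eigenvalue; - for $n=2k$, there exist a nonsingular Hermitian $H$ on $\mathbb{C}^{n}$ for which the space has rank $k$ and an indecomposable $H$-normal operator $N$ on $\mathbb{C}^{n}$ having exactly two distinct eigenvalues.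
   Context: Let $(\cdot,\cdot)$ be the standard inner product on $\mathbb{C}^n$. An indefinite scalar product on $\mathbb{C}^n$ is a nondegenerate sesquilinear Hermitian form $[\cdot,\cdot]$; it can be written $[x,y]=(Hx,y)$ for a unique nonsingular Hermitian operator $H$. The rank of the space is $\min\{v_-,v_+\}$, where $v_-$ (resp. $v_+$) is the number of negative (resp. positive) eigenvalues of $H$, counted with multiplicity. For a linear operator $A$, the $H$-adjoint $A^{[*]}$ is defined by $[A^{[*]}x,y]=[x,Ay]$ for all $x,y$. An operator $N$ is $H$-normal if $NN^{[*]}=N^{[*]}N$. For a subspace $V$, $V^{[\perp]}=\{x : [x,y]=0 \ \forall y\in V\}$. A nonzero subspace $V$ is nondegenerate if $x\in V$ and $[x,y]=0$ for all $y\in V$ imply $x=0$. A linear operator $A$ is decomposable if there is a nondegenerate proper nonzero subspace $V$ such that both $V$ and $V^{[\perp]}$ are invariant under $A$ (equivalently, $V$ is invariant under both $A$ and $A^{[*]}$). Otherwise $A$ is indecomposable. *)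

(* Defs.v *)
From mathcomp Require Export all_boot all_order all_algebra.
From mathcomp Require Export sesquilinear spectral.
From mathcomp Require Export complex reals.

Set Implicit Arguments.
Unset Strict Implicit.
Unset Printing Implicit Defensive.

Import Order.TTheory GRing.Theory Num.Theory.
Local Open Scope ring_scope.
Local Open Scope sesquilinear_scope.

(* Vectors of C^n are row vectors, and a matrix A : 'M_n stands for the
   operator x |-> x *m A. Subspaces are row spaces of matrices V : 'M_n. *)

Section IndefiniteScalarProduct.
Variable C : numClosedFieldType.

Definition iprod n (H : 'M[C]_n) (x y : 'rV[C]_n) : C := dotmx (x *m H) y.

(* The eigenvalues of A, repeated according to algebraic multiplicity. *)
Definition eigvals n (A : 'M[C]_n) : seq C :=
  sval (closed_field_poly_normal (char_poly A)).

Definition num_neg_eigvals n (H : 'M[C]_n) : nat :=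
  count (fun a => a < 0) (eigvals H).

Definition num_pos_eigvals n (H : 'M[C]_n) : nat :=
  count (fun a => 0 < a) (eigvals H).

Definition space_rank n (H : 'M[C]_n) : nat :=
  minn (num_neg_eigvals H) (num_pos_eigvals H).

Definition is_Hadjoint n (H A B : 'M[C]_n) : Prop :=
  forall x y : 'rV[C]_n, iprod H (x *m B) y = iprod H x (y *m A).

(* For nonsingular H the adjoint exists and is unique; see [is_HadjointE]. *)
Definition Hnormal n (H N : 'M[C]_n) : Prop :=
  exists2 B : 'M[C]_n, is_Hadjoint H N B & N *m B = B *m N.

Definition Hperp n (H V : 'M[C]_n) : 'M[C]_n := orthomx Num.conj H V.

Definition nondegenerate_subspace n (H V : 'M[C]_n) : Prop :=
  V != 0 /\
  forall x : 'rV[C]_n, (x <= V)%MS ->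
    (forall y : 'rV[C]_n, (y <= V)%MS -> iprod H x y = 0) -> x = 0.

Definition decomposable n (H A : 'M[C]_n) : Prop :=
  exists V : 'M[C]_n,
    [/\ nondegenerate_subspace H V, (V < 1%:M)%MS,
        stablemx V A & stablemx (Hperp H V) A].

Definition indecomposable n (H A : 'M[C]_n) : Prop := ~ decomposable H A.

Definition has_distinct_eigenvalues n (A : 'M[C]_n) (m : nat) : Prop :=
  exists s : seq C, [/\ uniq s, size s = m & s =i eigenvalue A].

Lemma iprodE n (H : 'M[C]_n) x y : iprod H x y = (x *m H *m y ^t*) 0 0.
Proof. by rewrite /iprod dotmxE. Qed.

Lemma char_poly_eigvals n (A : 'M[C]_n) :
  char_poly A = \prod_(a <- eigvals A) ('X - a%:P).
Proof.
rewrite /eigvals; case: closed_field_poly_normal => s /= {1}->.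
by rewrite (monicP (char_poly_monic A)) scale1r.
Qed.

Lemma mem_eigvals n (A : 'M[C]_n) : eigvals A =i eigenvalue A.
Proof.
move=> a; rewrite -[RHS]/(eigenvalue A a) eigenvalue_root_char.
by rewrite char_poly_eigvals root_prod_XsubC.
Qed.

Lemma is_HadjointE n (H A B : 'M[C]_n) : H \in unitmx ->
  is_Hadjoint H A B <-> B = H *m A ^t* *m invmx H.
Proof.
move=> uH; split => [adj|-> x y].
  suff <- : B *m H = H *m A ^t* by rewrite mulmxK.
  have entryE (M : 'M[C]_n) i j :
      ((delta_mx 0 i : 'rV_n) *m M *m (delta_mx 0 j : 'rV_n) ^t*) 0 0 = M i j.
    by rewrite trmx_delta map_delta_mx -rowE -colE !mxE.
  apply/matrixP => i j; have := adj (delta_mx 0 i) (delta_mx 0 j).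
  rewrite !iprodE trmx_mul map_mxM !mulmxA => e.
  by rewrite -[LHS]entryE -[RHS]entryE !mulmxA; exact: e.
by rewrite !iprodE trmx_mul map_mxM !mulmxA mulmxKV.
Qed.

Lemma HperpP n (H V : 'M[C]_n) (x : 'rV[C]_n) :
  (x <= Hperp H V)%MS <->
  (forall y : 'rV[C]_n, (y <= V)%MS -> iprod H x y = 0).
Proof.
rewrite /Hperp /orthomx sub_kermx mulmxA; split => [/eqP xV y /submxP[u ->]|xV].
  rewrite iprodE trmx_mul map_mxM mulmxA.
  rewrite [X in (X *m _) 0 0](_ : _ = 0) ?mul0mx ?mxE //.
apply/eqP/rowP => j; have := xV _ (row_sub j V); rewrite iprodE => e.
rewrite [RHS]mxE -[RHS]e !mxE; apply: eq_bigr => i _; by rewrite !mxE.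
Qed.

End IndefiniteScalarProduct.

(* Main.v *)
Require Import Defs.
From mathcomp Require Import zify ring.

(* Let B be the H-adjoint of N.  By indecomposability an H-selfadjoint
   idempotent commuting with N is 0 or 1.

   If P is the spectral idempotent of N at an eigenvalue, with adjoint P',
   then P P' is such an idempotent.  If P P' = 1 then P = 1 and N has one
   eigenvalue.  If P P' = 0 then P + P' is again such an idempotent, hence 1;
   the images of P and P' are neutral, so both have dimension at most k, and
   n = 2k.  Two distinct eigenvalues then have spectral subspaces of dimension
   k = n/2 each, which leaves no room for a third one.

   For a single eigenvalue, subtract it from N, so that N and B are nilpotent.
   For a neutral subspace L stable under N and B let G(L) be the space of
   x in L^[perp] with N x and B x in L, and L' = G(L) /\ G(L)^[perp].  The map
   x |-> (N x, B x) from G(L') to (L' / L)^2 has kernel inside G(L), so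
   dim G(L) <= dim L' + 2 dim L is preserved when L is replaced by L'.  It
   holds for L = 0, because the common kernel of N and B is neutral.  When
   L' = L, nilpotency on G(L)^[perp] / L forces G(L)^[perp] = L, and thus
   n <= dim L + (dim L + 2 dim L) = 4 dim L <= 4k.

   Sharpness: a Jordan block of size 2k that is selfadjoint for the flip form;
   diag(J, 1) for the hyperbolic form, J a Jordan block of size k; and a
   4 x 4 block matrix on b, p, q, a (k coordinates each) acting by
   N : b |-> T p + S q, p |-> a and B : b |-> p, p |-> T* a, q |-> S* a, where
   T is a multiple of J and T T* + S S* = 1. *)

Set Implicit Arguments.
Unset Strict Implicit.
Unset Printing Implicit Defensive.

Import Order.TTheory GRing.Theory Num.Theory.
Local Open Scope ring_scope.
Local Open Scope sesquilinear_scope.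

(** * Signature of a Hermitian form and its semidefinite subspaces *)

Section Signature.
Variable C : numClosedFieldType.

Lemma hermP n (H : 'M[C]_n) : reflect (H ^t* = H) (H \is hermsymmx).
Proof.
by rewrite is_hermitianmxE expr0 scale1r eq_sym; exact: eqP.
Qed.

Lemma ctrM m n p (A : 'M[C]_(m, n)) (B : 'M[C]_(n, p)) :
  (A *m B) ^t* = B ^t* *m A ^t*.
Proof. by rewrite trmx_mul map_mxM. Qed.

Lemma char_poly_conj n (P D : 'M[C]_n) : P \in unitmx ->
  char_poly (invmx P *m D *m P) = char_poly D.
Proof.
move=> uP; rewrite /char_poly.
have -> : char_poly_mx (invmx P *m D *m P) =
    map_mx polyC (invmx P) *m char_poly_mx D *m map_mx polyC P.
  rewrite /char_poly_mx mulmxBr mulmxBl.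
  rewrite scalar_mxC -(mulmxA 'X%:M) -!map_mxM.
  by rewrite mulVmx // map_mx1 mulmx1.
rewrite !det_mulmx mulrAC -det_mulmx -map_mxM mulVmx //.
by rewrite map_mx1 det1 mul1r.
Qed.

Lemma perm_eigvals_spectral n (H : 'M[C]_n) : H \is normalmx ->
  perm_eq (eigvals H) [seq spectral_diag H 0 i | i : 'I_n].
Proof.
move=> /orthomx_spectralP HE; apply: prod_XsubC_eq.
rewrite -char_poly_eigvals {1}HE char_poly_conj ?spectral_unit //.
rewrite char_poly_trig ?diag_mx_is_trig // big_image /=.
by apply: eq_bigr => i _; rewrite !mxE eqxx mulr1n.
Qed.

Lemma count_eigvals n (H : 'M[C]_n) (a : pred C) : H \is normalmx ->
  count a (eigvals H) = #|[set i | a (spectral_diag H 0 i)]|.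
Proof.
move=> /perm_eigvals_spectral/permP/(_ a) ->.
rewrite -sum1_count -sum1_card big_image_cond /=.
by apply: eq_bigl => i; rewrite !inE.
Qed.

Lemma form_spectral n (H : 'M[C]_n) (z : 'rV[C]_n) : H \is normalmx ->
  (z *m H *m z ^t*) 0 0 =
  \sum_i spectral_diag H 0 i * `|(z *m (spectralmx H) ^t*) 0 i| ^+ 2.
Proof.
move=> /orthomx_spectralP HE; rewrite {1}HE.
rewrite invmx_unitary ?spectral_unitarymx //.
set P := spectralmx H; set u := z *m P ^t*; rewrite !mulmxA -/u -mulmxA.
rewrite (_ : P *m z ^t* = u ^t*); last by rewrite ctrM trmxCK.
rewrite mxE; apply: eq_bigr => i _; rewrite mul_mx_diag !mxE normCK.
by rewrite mulrAC mulrC.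
Qed.

(** On the span of the eigenvectors with [s * a < 0] the form times [s] is negative definite, so
    that span meets [V] trivially. The factor [s] lets one proof serve both signs. *)
Lemma semidefinite_bound m n (H : 'M[C]_n) (s : C) (V : 'M[C]_(m, n)) :
    H \is hermsymmx -> s \is Num.real ->
    (forall x : 'rV_n, (x <= V)%MS -> 0 <= s * (x *m H *m x ^t*) 0 0) ->
  (\rank V + count (fun a => s * a < 0)%R (eigvals H) <= n)%N.
Proof.
move=> hH rs V0; have nH := hermitian_normalmx hH.
rewrite count_eigvals //; set S := [set i | _]; set d := spectral_diag H.
pose P := spectralmx H; pose W := rowsub (@enum_val _ (mem S)) P.
have uP : P *m P ^t* = 1%:M by apply/unitarymxP; exact: spectral_unitarymx.
have WP : W *m P ^t* = rowsub (@enum_val _ (mem S)) 1%:M.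
  by rewrite mul_rowsub_mx uP.
have uW : W \is unitarymx.
  apply/unitarymxP/matrixP => i j.
  have := congr1 (fun M : 'M[C]_n => M (enum_val i) (enum_val j)) uP.
  rewrite !mxE (inj_eq enum_val_inj) => <-; apply: eq_bigr => l _.
  by rewrite !mxE.
rewrite -(mxrank_unitary uW) -mxrank_sum_cap.
suff -> : (V :&: W)%MS = 0 by rewrite mxrank0 addn0 rank_leq_col.
apply/eqP/rowV0P => z; rewrite sub_capmx => /andP[/V0 + /submxP[y zE]].
rewrite form_spectral //; set u := z *m _ => ge0.
have u0 i : i \notin S -> u 0 i = 0.
  move=> iS; rewrite /u zE -mulmxA WP mxE big1 // => j _; rewrite !mxE.
  by case: eqP iS => [<-|_]; rewrite ?enum_valP // mulr0.
have le0 i : 0 <= - (s * (d 0 i * `|u 0 i| ^+ 2)).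
  rewrite oppr_ge0; have [iS|/u0 ->] := boolP (i \in S).
    by rewrite mulrA mulr_le0_ge0 ?exprn_ge0 //; move: iS; rewrite inE => /ltW.
  by rewrite normr0 expr0n !mulr0.
have sum0 : \sum_i - (s * (d 0 i * `|u 0 i| ^+ 2)) = 0.
  apply/eqP; rewrite eq_le sumr_ge0 ?andbT; last by move=> i _; exact: le0.
  by rewrite sumrN oppr_le0 -mulr_sumr.
suff u_0 : u = 0 by rewrite -[z]mulmx1 -(mulmx1C uP) mulmxA -/u u_0 mul0mx.
apply/rowP => i; rewrite [RHS]mxE; have [iS|/u0 //] := boolP (i \in S).
move/psumr_eq0P: sum0 => /(_ (fun i _ => le0 i) i isT)/eqP.
rewrite oppr_eq0 mulrA mulf_eq0 expf_eq0 normr_eq0 /= => /orP[|/eqP //].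
by move: iS; rewrite inE => /lt_eqF ->.
Qed.

Lemma neg_pos_eigvals n (H : 'M[C]_n) : H \is hermsymmx -> H \in unitmx ->
  (num_neg_eigvals H + num_pos_eigvals H)%N = n.
Proof.
move=> hH uH; have nH := hermitian_normalmx hH.
rewrite /num_neg_eigvals /num_pos_eigvals !count_eigvals //.
rewrite -[RHS]card_ord -(cardsC [set i | spectral_diag H 0 i < 0]).
congr (_ + _)%N; apply: eq_card => i; rewrite !inE.
have /mxOverP/(_ 0 i) dR := hermitian_spectral_diag_real hH.
suff d0 : spectral_diag H 0 i != 0.
  by rewrite lt_def d0 real_leNgt ?real0.
apply: contraTneq uH => di0; rewrite (orthomx_spectralP nH) unitmxE !det_mulmx.
rewrite det_diag (bigD1 i) //= di0 mul0r mulr0 mul0r unitfE eqxx //.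
Qed.

Lemma semidefinite_pos_bound m n (H : 'M[C]_n) (V : 'M[C]_(m, n)) :
    H \is hermsymmx ->
    (forall x : 'rV_n, (x <= V)%MS -> 0 <= (x *m H *m x ^t*) 0 0) ->
  (\rank V + num_neg_eigvals H <= n)%N.
Proof.
move=> hH V0; have -> : num_neg_eigvals H = count (fun a => 1 * a < 0)%R (eigvals H).
  by apply: eq_count => a; rewrite mul1r.
by apply: semidefinite_bound => // x /V0; rewrite mul1r.
Qed.

(** A neutral subspace is both positive and negative semidefinite, so its dimension is at most n -
    v_- = v_+ and at most n - v_+ = v_-. *)
Lemma neutral_rank m n (H : 'M[C]_n) (V : 'M[C]_(m, n)) :
    H \is hermsymmx -> H \in unitmx -> V *m H *m V ^t* = 0 ->
  (\rank V <= space_rank H)%N.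
Proof.
move=> hH uH VV.
have V0 (x : 'rV_n) : (x <= V)%MS -> (x *m H *m x ^t*) 0 0 = 0.
  case/submxP => y ->; rewrite ctrM !mulmxA -2!(mulmxA y) VV.
  by rewrite mulmx0 mul0mx mxE.
have neg : (\rank V + num_neg_eigvals H <= n)%N.
  by apply: semidefinite_pos_bound => // x /V0 ->.
have pos : (\rank V + num_pos_eigvals H <= n)%N.
  have -> : num_pos_eigvals H = count (fun a => -1 * a < 0)%R (eigvals H).
    by apply: eq_count => a; rewrite mulN1r oppr_lt0.
  by apply: semidefinite_bound; rewrite ?realN ?real1 // => x /V0 ->; rewrite mulr0.
by have := neg_pos_eigvals hH uH; rewrite /space_rank; lia.
Qed.

Lemma space_rank_le n (H : 'M[C]_n) : H \is hermsymmx -> H \in unitmx ->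
  (2 * space_rank H <= n)%N.
Proof.
by move=> hH uH; have := neg_pos_eigvals hH uH; rewrite /space_rank; lia.
Qed.
End Signature.

(** * The H-adjoint, orthogonal complements, and decompositions as idempotents *)

Section Adjoint.
Variables (C : numClosedFieldType) (n : nat) (H : 'M[C]_n).

Definition Hadj (A : 'M[C]_n) := H *m A ^t* *m invmx H.

Lemma sub_HperpE p (X : 'M[C]_(p, n)) (V : 'M[C]_n) :
  (X <= Hperp H V)%MS = (X *m H *m V ^t* == 0).
Proof. by rewrite /Hperp /orthomx sub_kermx mulmxA. Qed.

Lemma HperpS (V W : 'M[C]_n) : (V <= W)%MS -> (Hperp H W <= Hperp H V)%MS.
Proof.
case/submxP => D ->; rewrite sub_HperpE ctrM mulmxA.
by have := submx_refl (Hperp H W); rewrite sub_HperpE => /eqP ->; rewrite mul0mx.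
Qed.

Hypotheses (hH : H \is hermsymmx) (uH : H \in unitmx).
Let HC : H ^t* = H. Proof. exact/hermP. Qed.

Lemma Hadj_form A : Hadj A *m H = H *m A ^t*.
Proof. by rewrite /Hadj mulmxKV. Qed.

Lemma Hadj_unique A B : B *m H = H *m A ^t* -> B = Hadj A.
Proof. by move=> e; rewrite /Hadj -e mulmxK. Qed.

Lemma HadjM A B : Hadj (A *m B) = Hadj B *m Hadj A.
Proof.
apply/esym/Hadj_unique.
by rewrite -mulmxA Hadj_form mulmxA Hadj_form -mulmxA -ctrM.
Qed.

Lemma HadjK A : Hadj (Hadj A) = A.
Proof. by apply/esym/Hadj_unique; rewrite -[in RHS]HC -ctrM Hadj_form ctrM trmxCK HC. Qed.

Lemma HadjD A B : Hadj (A + B) = Hadj A + Hadj B.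
Proof. by rewrite /Hadj linearD map_mxD mulmxDr mulmxDl. Qed.

Lemma Hadj1 : Hadj 1%:M = 1%:M.
Proof. by rewrite /Hadj trmx1 map_mx1 mulmx1 mulmxV. Qed.

Lemma HadjX A m : Hadj (A ^+ m) = Hadj A ^+ m.
Proof.
elim: m => [|m IHm]; first by rewrite !expr0; exact: Hadj1.
by rewrite exprS exprSr -IHm; exact: HadjM.
Qed.

Lemma Hperp_sym (V W : 'M[C]_n) : (V <= Hperp H W)%MS = (W <= Hperp H V)%MS.
Proof.
have e : (V *m H *m W ^t*) ^t* = W *m H *m V ^t*.
  by rewrite !ctrM trmxCK HC mulmxA.
rewrite !sub_HperpE -e; apply/eqP/eqP => [->|]; first by rewrite trmx0 map_mx0.
by move/(congr1 (fun M : 'M[C]_n => M ^t*)); rewrite trmxCK trmx0 map_mx0.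
Qed.

Lemma rank_Hperp (V : 'M[C]_n) : \rank (Hperp H V) = (n - \rank V)%N.
Proof.
rewrite /Hperp /orthomx mxrank_ker; congr (_ - _)%N.
rewrite -mxrank_tr trmx_mul mxrankMfree ?row_free_unit ?unitmx_tr //.
by rewrite -map_trmx trmxK mxrank_map.
Qed.

Lemma Hperp_stable (V A : 'M[C]_n) :
  stablemx V A -> stablemx (Hperp H V) (Hadj A).
Proof.
case/submxP => D VA; rewrite sub_HperpE.
rewrite -(mulmxA _ (Hadj A)) Hadj_form -!mulmxA -ctrM VA ctrM !mulmxA.
by have := submx_refl (Hperp H V); rewrite sub_HperpE => /eqP ->; rewrite mul0mx.
Qed.

(** The decomposing subspace is the image of [E]; as [E] is selfadjoint, the orthogonal complement
    of its image is its kernel. *)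
Lemma idempotent_decomposable (E N : 'M[C]_n) :
    E *m E = E -> Hadj E = E -> E *m N = N *m E -> E != 0 -> E != 1%:M ->
  decomposable H N.
Proof.
move=> EE EH EN E0 E1; have EHE : E *m H = H *m E ^t* by rewrite -Hadj_form EH.
exists E; split.
- split=> // x xE x0; have {}xE : x *m E = x by case/submxP: xE => y ->; rewrite -mulmxA EE.
  suff : x *m H = 0 by move/(congr1 (mulmxr (invmx H))); rewrite /= mulmxK // mul0mx.
  apply/eqP; rewrite -xE -mulmxA EHE mulmxA -sub_HperpE.
  by apply/HperpP.
- rewrite ltmxE submx1 sub1mx row_full_unit; apply: contra E1 => uE.
  by rewrite -(mulKmx uE E) EE mulVmx.
- by rewrite EN submxMl.
- rewrite sub_HperpE -mulmxA -EHE !mulmxA.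
  rewrite -(mulmxA _ N) -EN mulmxA.
  have := submx_refl (Hperp H E); rewrite sub_HperpE -mulmxA -EHE mulmxA.
  move/eqP/(congr1 (mulmxr (invmx H))); rewrite /= mulmxK // mul0mx => ->.
  by rewrite !mul0mx.
Qed.

(** Nondegeneracy makes [V] and its orthogonal complement complementary; [E] is the projection onto
    [V] along that complement, and orthogonality of the two summands makes it selfadjoint. *)
Lemma decomposable_idempotent (N : 'M[C]_n) : decomposable H N ->
  exists E : 'M[C]_n,
    [/\ E *m E = E, Hadj E = E, E *m N = N *m E, E != 0 & E != 1%:M].
Proof.
case=> V [[V0 ndV] V1 sV sW]; set W := Hperp H V in sW *.
have VW : (V :&: W)%MS = 0.
  apply/eqP/rowV0P => x; rewrite sub_capmx => /andP[xV /HperpP]; exact: ndV.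
have VW1 : (V + W :=: 1%:M)%MS.
  apply/eqmxP; rewrite submx1 sub1mx /row_full (mxrank_disjoint_sum VW).
  by rewrite rank_Hperp subnKC ?rank_leq_row //= eqxx.
pose E := proj_mx V W.
have EV : (E <= V)%MS by rewrite -[E]mul1mx proj_mx_sub.
have EW : (1%:M - E <= W)%MS.
  by rewrite -{1}[E]mul1mx proj_mx_compl_sub // VW1.
exists E; split.
- exact: proj_mx_proj.
- apply/esym/Hadj_unique.
  have WE : (1%:M - E) *m H *m E ^t* = 0.
    by apply/eqP; rewrite -sub_HperpE (submx_trans EW) // HperpS.
  have EWs : E *m H *m (1%:M - E) ^t* = 0.
    by apply/eqP; rewrite -sub_HperpE Hperp_sym sub_HperpE WE.
  move: WE EWs; rewrite mulmxBl mul1mx mulmxBl => /eqP; rewrite subr_eq0 => /eqP ->.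
  rewrite linearB /= trmx1 map_mxB map_mx1 mulmxBr mulmx1 => /eqP.
  by rewrite subr_eq0 => /eqP.
- have e1 : E *m N *m E = E *m N.
    by apply: proj_mx_id => //; rewrite (submx_trans _ sV) // submxMr.
  have e2 : (1%:M - E) *m N *m E = 0.
    by apply: proj_mx_0 => //; rewrite (submx_trans _ sW) // submxMr.
  by move: e2; rewrite mulmxBl mul1mx mulmxBl e1 => /eqP; rewrite subr_eq0 => /eqP.
- by apply: contraNneq V0 => E0; rewrite -(proj_mx_id VW (submx_refl V)) -/E E0 mulmx0.
- apply: contraTneq V1 => E1; rewrite ltmxE -E1 EV andbF //.
Qed.

Lemma indecomposable_idempotent (E N : 'M[C]_n) : indecomposable H N ->
    E *m E = E -> Hadj E = E -> E *m N = N *m E ->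
  E = 0 \/ E = 1%:M.
Proof.
move=> iN EE EH EN; have [->|E0] := eqVneq E 0; first by left.
have [->|E1] := eqVneq E 1%:M; first by right.
by case: iN; exact: idempotent_decomposable EE EH EN E0 E1.
Qed.

End Adjoint.

(** * Nilpotent matrices modulo a subspace, and dimension counts in quotients *)

Lemma nilpotent_mod (F : fieldType) n p q (A : 'M[F]_n) (K : 'M[F]_(p, n))
    (L : 'M[F]_(q, n)) m :
    A ^+ m = 0 -> ~~ (K <= L)%MS ->
  exists i, ~~ (K *m A ^+ i <= L)%MS /\ (K *m A ^+ i *m A <= L)%MS.
Proof.
move=> Am KL; have exL : exists i, (K *m A ^+ i <= L)%MS.
  by exists m; rewrite Am mulmx0 sub0mx.
case: (ex_minnP exL) => [[|i] iL imin].
  by move: KL; rewrite -[K]mulmx1 iL.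
exists i; rewrite -mulmxA mulmxE -exprSr iL; split=> //.
by apply/negP => /imin; rewrite ltnn.
Qed.

Lemma stablemxX (F : fieldType) n p (A : 'M[F]_n) (K : 'M[F]_(p, n)) i :
  stablemx K A -> stablemx K (A ^+ i).
Proof.
move=> sKA; elim: i => [|i IHi]; first by rewrite expr0 mulmx1.
by rewrite exprS -mulmxE mulmxA (submx_trans _ IHi) // submxMr.
Qed.

(** [nilpotent_mod] is used for [A] on [K], then for [B] on [K *m A ^+ i]. The powers of [B] do not
    spoil the first step, since they commute with [A] and preserve [L]. *)
Lemma commuting_nilpotent_mod (F : fieldType) n p q (A B : 'M[F]_n)
    (K : 'M[F]_(p, n)) (L : 'M[F]_(q, n)) m :
    A *m B = B *m A -> A ^+ m = 0 -> B ^+ m = 0 ->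
    stablemx K A -> stablemx K B -> stablemx L B -> ~~ (K <= L)%MS ->
  exists X : 'M[F]_(p, n),
    [/\ (X <= K)%MS, ~~ (X <= L)%MS, (X *m A <= L)%MS & (X *m B <= L)%MS].
Proof.
move=> AB Am Bm sKA sKB sLB KL.
have [i [iL iAL]] := nilpotent_mod Am KL.
have [j [jL jBL]] := nilpotent_mod Bm iL.
exists (K *m A ^+ i *m B ^+ j); split=> //.
  by rewrite (submx_trans (submxMr _ (stablemxX i sKA))) // stablemxX.
have -> : K *m A ^+ i *m B ^+ j *m A = K *m A ^+ i *m A *m B ^+ j.
  have : GRing.comm A (B ^+ j) by apply: commrX; exact: AB.
  by rewrite /GRing.comm -!mulmxE => c; rewrite -!mulmxA c.
by rewrite (submx_trans (submxMr _ iAL)) // stablemxX.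
Qed.

Lemma rank_mul_cokermx (F : fieldType) n p q (X : 'M[F]_(p, n)) (L : 'M[F]_(q, n)) :
  (L <= X)%MS -> (\rank (X *m cokermx L) + \rank L)%N = \rank X.
Proof.
move=> LX; rewrite -(mxrank_mul_ker X (cokermx L)); congr (_ + _)%N.
have kerL : (kermx (cokermx L) :=: L)%MS.
  apply/eqmxP; apply/andP; split; first by rewrite submxE mulmx_ker.
  by apply/sub_kermxP; rewrite mulmx_coker.
by rewrite (cap_eqmx (eqmx_refl X) kerL) (capmx_idPr LX).
Qed.

Lemma sub_kermx_coker (F : fieldType) n p q (A : 'M[F]_n) (X : 'M[F]_(p, n))
    (L : 'M[F]_(q, n)) :
  (X <= kermx (A *m cokermx L))%MS = (X *m A <= L)%MS.
Proof. by rewrite sub_kermx mulmxA -submxE. Qed.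

(** Rank-nullity for the map from [X] to M / L induced by [A], whose kernel consists of the vectors
    of [X] that [A] sends into [L]. *)
Lemma rank_preimage (F : fieldType) n p q r (A : 'M[F]_n) (X : 'M[F]_(p, n))
    (L : 'M[F]_(q, n)) (M : 'M[F]_(r, n)) :
    (L <= M)%MS -> (X *m A <= M)%MS ->
  (\rank X + \rank L <= \rank M + \rank (X :&: kermx (A *m cokermx L))%MS)%N.
Proof.
move=> LM XA; rewrite -(mxrank_mul_ker X (A *m cokermx L)).
rewrite -(rank_mul_cokermx LM) mulmxA.
by have := mxrankS (submxMr (cokermx L) XA); lia.
Qed.

(** * The bound n <= 4k for nilpotent operators *)

Section NilpotentBound.
Variables (C : numClosedFieldType) (n : nat) (H A B : 'M[C]_n) (m : nat).
Hypotheses (hH : H \is hermsymmx) (uH : H \in unitmx).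
Hypotheses (BE : B = Hadj H A) (AB : A *m B = B *m A) (Am : A ^+ m = 0).
Hypothesis neutral_kernel :
  forall X : 'M[C]_n, X *m A = 0 -> X *m B = 0 -> X *m H *m X ^t* = 0.

(* Preimage in L^[perp] of the common kernel of A and B on L^[perp] / L. *)
Definition socle (L : 'M[C]_n) : 'M[C]_n :=
  (Hperp H L :&: kermx (A *m cokermx L) :&: kermx (B *m cokermx L))%MS.

Lemma sub_socle p (X : 'M[C]_(p, n)) L :
  (X <= socle L)%MS = [&& X <= Hperp H L, X *m A <= L & X *m B <= L]%MS.
Proof.
by rewrite /socle 2!sub_capmx andbA; congr (_ && _ && _); exact: sub_kermx_coker.
Qed.

(** The radical of the form on [socle L]; it replaces [L] in the iteration. *)
Definition socle_rad L : 'M[C]_n := (socle L :&: Hperp H (socle L))%MS.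

(** The invariant of the iteration. Its last clause says that the nondegenerate quotient of
    [socle L] by its radical has at most twice the dimension of [L]. *)
Definition admissible L : Prop :=
  [/\ stablemx L A, stablemx L B, (L <= Hperp H L)%MS &
      (\rank (socle L) <= \rank (socle_rad L) + 2 * \rank L)%N].

(** [socle 0] is the common kernel of [A] and [B]; being neutral, it is its own radical. *)
Lemma admissible0 : admissible 0.
Proof.
split; rewrite ?mul0mx ?sub0mx // mxrank0 muln0 addn0 mxrankS // sub_capmx.
rewrite submx_refl sub_HperpE; apply/eqP/neutral_kernel.
  by have := submx_refl (socle 0); rewrite sub_socle => /and3P[_ + _]; rewrite submx0 => /eqP.
by have := submx_refl (socle 0); rewrite sub_socle => /and3P[_ _ +]; rewrite submx0 => /eqP.
Qed.

Lemma sub_socle_rad L : admissible L -> (L <= socle_rad L)%MS.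
Proof.
case=> sA sB LL _; rewrite sub_capmx sub_socle LL sA sB Hperp_sym //.
by have := submx_refl (socle L); rewrite sub_socle => /and3P[].
Qed.

Lemma admissible_rad L : admissible L -> admissible (socle_rad L).
Proof.
(* Here l, r, s are the dimensions of [L], of R = [socle_rad L] and of [socle_rad R]; gL and gR
   those of the socles of [L] and R; x and y those of the successive kernels of [A] and [B] modulo
   [L]. Thus gR <= 2(r - l) + gL <= 3r <= s + 2r. *)
have arith gR l r x y gL s : (gR + l <= r + x -> x + l <= r + y -> y <= gL ->
  gL <= r + 2 * l -> r <= s -> gR <= s + 2 * r)%N by clear; lia.
move=> aL; have LR := sub_socle_rad aL; case: (aL) => sA sB LL rL.
set R := socle_rad L; have /andP[RS RP] : (R <= socle L)%MS && (R <= Hperp H (socle L))%MS.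
  by rewrite -sub_capmx.
have RR : (R <= Hperp H R)%MS := submx_trans RP (HperpS H RS).
have /and3P[_ RA RB] : [&& R <= Hperp H L, R *m A <= L & R *m B <= L]%MS.
  by rewrite -sub_socle.
have sRA : stablemx R A by rewrite (submx_trans RA).
have sRB : stablemx R B by rewrite (submx_trans RB).
have aR : (R <= socle_rad R)%MS.
  rewrite sub_capmx sub_socle RR sRA sRB Hperp_sym //.
  by have := submx_refl (socle R); rewrite sub_socle => /and3P[].
split=> //.
have /and3P[GR GA GB] : [&& socle R <= Hperp H R, socle R *m A <= R & socle R *m B <= R]%MS.
  by rewrite -sub_socle.
have := rank_preimage LR GA; set X := (socle R :&: _)%MS => hX.
have XB : (X *m B <= R)%MS := submx_trans (submxMr B (capmxSl _ _)) GB.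
have := rank_preimage LR XB; set Y := (X :&: _)%MS => hY.
have YL : (Y <= socle L)%MS.
  have YX : (Y <= X)%MS by exact: capmxSl.
  have YG : (Y <= socle R)%MS := submx_trans YX (capmxSl _ _).
  have YA : (Y *m A <= L)%MS.
    by rewrite -sub_kermx_coker; exact: submx_trans YX (capmxSr _ _).
  have YB : (Y *m B <= L)%MS by rewrite -sub_kermx_coker; exact: capmxSr.
  rewrite sub_socle; apply/and3P; split=> //.
  exact: submx_trans YG (submx_trans GR (HperpS H LR)).
exact: arith hX hY (mxrankS YL) rL (mxrankS aR).
Qed.

Lemma exists_maximal_admissible :
  exists2 L, admissible L & (socle_rad L <= L)%MS.
Proof.
suff: forall d L, (n - \rank L < d)%N -> admissible L ->
    exists2 L, admissible L & (socle_rad L <= L)%MS.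
  by move/(_ n.+1 0); apply; [rewrite ltnS leq_subr | exact: admissible0].
elim=> [|d IHd] L; first by rewrite ltn0.
move=> Ld aL; have /orP[RL|RL] := orbN (socle_rad L <= L)%MS.
  by exists L.
apply: (IHd (socle_rad L)); last exact: admissible_rad.
have : (L < socle_rad L)%MS by rewrite ltmxE sub_socle_rad.
rewrite ltmxErank => /andP[_].
by have := rank_leq_row (socle_rad L); lia.
Qed.

Lemma nilpotent_bound : (n <= 4 * space_rank H)%N.
Proof.
(* With p = n, and s, r, l the dimensions of [socle L], [socle_rad L] and [L]: n <= l + s <= l + (r
   + 2l) <= 4l <= 4k. *)
have arith p s r l k : (p - s <= l -> r <= l -> s <= r + 2 * l -> l <= k ->
  p <= 4 * k)%N by clear; lia.
have [L aL RL] := exists_maximal_admissible; case: (aL) => sA sB LL rL.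
have Lk : (\rank L <= space_rank H)%N.
  by apply: neutral_rank => //; apply/eqP; rewrite -sub_HperpE.
have /andP[LS LP] : (L <= socle L)%MS && (L <= Hperp H (socle L))%MS.
  by rewrite -sub_capmx sub_socle_rad.
have /and3P[_ SA SB] : [&& socle L <= Hperp H L, socle L *m A <= L & socle L *m B <= L]%MS.
  by rewrite -sub_socle.
suff PL : (Hperp H (socle L) <= L)%MS.
  by have := mxrankS PL; rewrite rank_Hperp // => /arith; apply; [exact: mxrankS RL| |].
(* Otherwise [A] and [B] act as commuting nilpotents on the complement of the socle modulo [L]. A
   nonzero class killed by both lies in [socle_rad L], which is contained in [L]. *)
apply: contraT => PL.
have Bm : B ^+ m = 0.
  by rewrite BE -HadjX // Am /Hadj trmx0 map_mx0 mulmx0 mul0mx.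
have sPA : stablemx (Hperp H (socle L)) A.
  by rewrite -[A](HadjK hH uH) -BE Hperp_stable // (submx_trans SB).
have sPB : stablemx (Hperp H (socle L)) B.
  by rewrite BE Hperp_stable // (submx_trans SA).
have [X [XP XL XA XB]] := commuting_nilpotent_mod AB Am Bm sPA sPB sB PL.
case/negP: XL; apply: submx_trans RL; rewrite sub_capmx XP sub_socle XA XB.
by rewrite (submx_trans XP) // HperpS.
Qed.

End NilpotentBound.

(** * Single eigenvalues, and neutrality of the common kernel *)

Lemma mul_eigenvectorX (F : fieldType) n (A : 'M[F]_n) (x : 'rV[F]_n) a m :
  x *m A = a *: x -> x *m A ^+ m = a ^+ m *: x.
Proof.
move=> xA; elim: m => [|m IHm]; first by rewrite !expr0 mulmx1 scale1r.
by rewrite exprS -mulmxE mulmxA xA -scalemxAl IHm scalerA -exprS.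
Qed.

Lemma eigenvalue_nilpotent (F : fieldType) n (N : 'M[F]_n) l a m :
  (N - l%:M) ^+ m = 0 -> eigenvalue N a -> a = l.
Proof.
move=> Nm /eigenvalueP[x xN x0]; apply/eqP; rewrite -subr_eq0.
have : x *m (N - l%:M) = (a - l) *: x.
  by rewrite mulmxBr xN mul_mx_scalar scalerBl.
move/(mul_eigenvectorX m); rewrite Nm mulmx0 => /esym/eqP.
by rewrite scaler_eq0 (negPf x0) orbF expf_eq0 => /andP[].
Qed.

Lemma one_eigenvalue (C : numClosedFieldType) n (N : 'M[C]_n) l m :
  (0 < n)%N -> (N - l%:M) ^+ m = 0 -> has_distinct_eigenvalues N 1.
Proof.
move=> n0 Nm; have [b Nb] := eigenvalue_closed N n0.
have bl := eigenvalue_nilpotent Nm Nb.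
exists [:: l]; split=> // a; rewrite inE; apply/eqP/idP => [->|].
  by rewrite -bl.
exact: eigenvalue_nilpotent Nm.
Qed.

(** Polarization: testing on e_i + a e_j with a = 1 and a = ['i] gives two independent relations
    between [G i j] and [G j i]. *)
Lemma form_eq0 (C : numClosedFieldType) n (G : 'M[C]_n) :
  (forall u : 'rV_n, u *m G *m u ^t* = 0) -> G = 0.
Proof.
move=> G0; have GE (i j : 'I_n) :
    (delta_mx 0 i : 'rV_n) *m G *m (delta_mx 0 j : 'rV_n) ^t* = (G i j)%:M.
  by apply/rowP => l; rewrite ord1 trmx_delta map_delta_mx -rowE -colE !mxE.
have Gd i : G i i = 0.
  by have := G0 (delta_mx 0 i); rewrite GE => /rowP/(_ 0); rewrite !mxE.
have polar (a : C) i j : a * G j i + a^* * G i j = 0.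
  have := G0 (delta_mx 0 i + a *: delta_mx 0 j).
  rewrite linearD linearZ /= map_mxD map_mxZ !mulmxDl !mulmxDr.
  rewrite -!scalemxAr -!scalemxAl !GE !Gd => /rowP/(_ 0).
  by rewrite !mxE /= !mulr1n !mulr0 add0r addr0 addrC.
apply/matrixP => i j; rewrite [RHS]mxE.
have := polar 1 i j; rewrite rmorph1 !mul1r => /eqP; rewrite addr_eq0 => /eqP e.
have := polar 'i i j; rewrite e conjCi mulrN mulNr -opprD => /eqP.
by rewrite oppr_eq0 -mulr2n mulrn_eq0 mulf_eq0 /= (negPf (neq0Ci _)) => /eqP.
Qed.

(** If x in the common kernel had [x,x] nonzero, the orthogonal projection onto its line would be a
    selfadjoint idempotent commuting with [A]. It has rank one, and [1 < n] keeps it from being the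
    identity. *)
Lemma common_kernel_neutral (C : numClosedFieldType) n (H A : 'M[C]_n) :
    H \is hermsymmx -> H \in unitmx -> (1 < n)%N ->
    (forall E, E *m E = E -> Hadj H E = E -> E *m A = A *m E ->
       E = 0 \/ E = 1%:M) ->
  forall X : 'M[C]_n, X *m A = 0 -> X *m Hadj H A = 0 -> X *m H *m X ^t* = 0.
Proof.
move=> hH uH n1 indec X XA XB; apply: form_eq0 => u.
rewrite !mulmxA -mulmxA -ctrM -mulmxA mulmxA; set x := u *m X.
have xA : x *m A = 0 by rewrite -mulmxA XA mulmx0.
have xB : x *m Hadj H A = 0 by rewrite -mulmxA XB mulmx0.
clearbody x; have HC : H ^t* = H by apply/hermP.
rewrite [LHS]mx11_scalar; set c := (x *m H *m x ^t*) 0 0.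
have [->|c0] := eqVneq c 0; first by rewrite raddf0.
have xHx : x *m H *m x ^t* = c%:M by rewrite [LHS]mx11_scalar.
have cC : c^* = c.
  have : (x *m H *m x ^t*) ^t* = x *m H *m x ^t*.
    by rewrite !ctrM trmxCK HC mulmxA.
  by rewrite xHx => /rowP/(_ 0); rewrite !mxE.
pose E : 'M[C]_n := c^-1 *: (H *m x ^t* *m x).
have xE : x *m E = x.
  by rewrite /E -scalemxAr !mulmxA xHx mul_scalar_mx scalerA mulVf // scale1r.
have EE : E *m E = E.
  by rewrite {1}/E -scalemxAl -(mulmxA (H *m x ^t*)) xE.
have EH : Hadj H E = E.
  apply/esym/Hadj_unique; rewrite // /E linearZ /= map_mxZ /= rmorphV ?unitfE //.
  by rewrite [X in H *m (X^-1 *: _)]cC !ctrM trmxCK HC -scalemxAl -scalemxAr !mulmxA.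
have EA : E *m A = 0 by rewrite /E -scalemxAl -!mulmxA xA !mulmx0 scaler0.
have AE : A *m E = 0.
  rewrite /E -scalemxAr !mulmxA -{1}(HadjK hH uH A) Hadj_form // -(mulmxA H) -ctrM.
  by rewrite xB trmx0 map_mx0 mulmx0 mul0mx scaler0.
case: (indec E EE EH) => [|E0|E1]; first by rewrite EA AE.
  by move: c0; rewrite /c -xE E0 !(mulmx0, mul0mx) mxE eqxx.
have := mxrank1 C n; rewrite -E1 => rE; move: n1; rewrite -rE ltnNge => /negP[].
by rewrite /E (leq_trans (mxrank_scale _ _)) // (leq_trans (mxrankM_maxr _ _)) // rank_leq_row.
Qed.

(** * Spectral idempotents *)

Lemma coprime_kernel (F : fieldType) n p (N : 'M[F]_n.+1) (X : 'M[F]_(p, n.+1))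
    (f g : {poly F}) :
    coprimep f g -> X *m horner_mx N f = 0 -> X *m horner_mx N g = 0 -> X = 0.
Proof.
case/Bezout_eq1_coprimepP => -[u v] /= uv Xf Xg.
rewrite -[X]mulmx1 -[1%:M](rmorph1 (horner_mx N)) -uv rmorphD !rmorphM /=.
have com h w : horner_mx N h * horner_mx N w = horner_mx N w * horner_mx N h.
  by rewrite -!rmorphM mulrC.
by rewrite com (com v) mulmxDr -!mulmxE !mulmxA Xf Xg !mul0mx addr0.
Qed.

(** Write the characteristic polynomial as (X - l)^m q with q(l) nonzero. A Bezout relation u (X -
    l)^m + v q = 1 provides P = (v q)(N), which commutes with whatever commutes with [N]. *)
Lemma spectral_idempotent (F : fieldType) n (N : 'M[F]_n.+1) l :
    eigenvalue N l ->
  exists P m, [/\ P *m P = P, P != 0,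
    P *m horner_mx N (('X - l%:P) ^+ m) = 0 &
    forall M, M *m N = N *m M -> M *m P = P *m M].
Proof.
move=> Nl; have [m [q]] := multiplicity_XsubC (char_poly N) l.
rewrite monic_neq0 ?char_poly_monic //= => ql cE.
have m0 : (0 < m)%N.
  rewrite lt0n; apply: contraNneq ql => m0.
  by rewrite eigenvalue_root_char cE m0 expr0 mulr1 in Nl.
have /Bezout_eq1_coprimepP[[u v] /= uv] : coprimep (('X - l%:P) ^+ m) q.
  by rewrite coprimep_expl // coprimep_sym coprimep_XsubC.
have CH w : horner_mx N (w * q * ('X - l%:P) ^+ m) = 0.
  by rewrite -mulrA -cE rmorphM /= Cayley_Hamilton mulr0.
exists (horner_mx N (v * q)), m; split.
- rewrite mulmxE -rmorphM /=.
  have -> : v * q * (v * q) = v * q - u * v * q * ('X - l%:P) ^+ m.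
    have -> : v * q = 1 - u * ('X - l%:P) ^+ m by rewrite -uv addrAC subrr add0r.
    rewrite -!mulrA (_ : v * (q * _) = (v * q) * ('X - l%:P) ^+ m); last by rewrite mulrA.
    have -> : v * q = 1 - u * ('X - l%:P) ^+ m by rewrite -uv addrAC subrr add0r.
    by rewrite mulrBr mulr1 mulrCA.
  by rewrite rmorphB /= CH subr0.
(* At l the Bezout relation gives (v q)(l) = 1, so v q is coprime to X - l and cannot kill an
   eigenvector for l. *)
- apply/eqP => P0; have /eigenvalueP[x xN] := Nl; case/eqP.
  apply: (@coprime_kernel _ _ _ N x ('X - l%:P) (v * q)).
  + rewrite coprimep_sym coprimep_XsubC; apply/negP => /eqP r0.
    have := congr1 (horner^~ l) uv; rewrite hornerD r0 addr0 hornerM horner_exp.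
    by rewrite hornerXsubC subrr expr0n eqn0Ngt m0 mulr0 hornerC => /eqP; rewrite eq_sym oner_eq0.
  + by rewrite rmorphB /= horner_mx_X horner_mx_C mulmxBr xN mul_mx_scalar subrr.
  + by rewrite P0 mulmx0.
- by rewrite mulmxE -rmorphM /= CH.
- by move=> M MN; exact: comm_mx_horner.
Qed.

(** * Eigenvalues and dimension of an indecomposable operator *)

Section Bounds.
Variables (C : numClosedFieldType) (n : nat) (H N : 'M[C]_n.+1).
Hypotheses (hH : H \is hermsymmx) (uH : H \in unitmx).
Hypotheses (normN : N *m Hadj H N = Hadj H N *m N) (indN : indecomposable H N).

Lemma horner_mx_XsubC_exp l m :
  horner_mx N (('X - l%:P) ^+ m) = (N - l%:M) ^+ m.
Proof. by rewrite rmorphXn rmorphB /= horner_mx_X horner_mx_C. Qed.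

Lemma nilpotent_case l m : (0 < space_rank H)%N -> (N - l%:M) ^+ m = 0 ->
  (n.+1 <= 4 * space_rank H)%N.
Proof.
move=> k0 Nm; set A := N - l%:M in Nm.
have NE : N = A + l%:M by rewrite /A subrK.
have lC (M : 'M[C]_n.+1) : l%:M *m M = M *m l%:M by rewrite scalar_mxC.
have AN M : M *m A = A *m M -> M *m N = N *m M.
  by move=> MA; rewrite NE mulmxDl mulmxDr MA lC.
have NA M : M *m N = N *m M -> M *m A = A *m M.
  by move=> MN; rewrite /A mulmxBl mulmxBr MN lC.
have AB : A *m Hadj H A = Hadj H A *m A.
  have NA' : N *m Hadj H A = Hadj H A *m N.
    by rewrite -[N](HadjK hH uH) -!HadjM //; congr Hadj; apply/esym/NA; rewrite normN.
  by apply/esym/NA.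
have n1 : (1 < n.+1)%N by have := space_rank_le hH uH; lia.
apply: (nilpotent_bound hH uH erefl AB Nm).
apply: common_kernel_neutral => // E EE EH EA.
by apply: (indecomposable_idempotent uH indN) => //; exact: AN.
Qed.

Lemma eigenvalue_dichotomy l : eigenvalue N l ->
  (exists m, (N - l%:M) ^+ m = 0) \/
  exists P m, [/\ P *m P = P, \rank P = space_rank H,
    P *m horner_mx N (('X - l%:P) ^+ m) = 0, P *m N = N *m P &
    n.+1 = (2 * space_rank H)%N].
Proof.
case/spectral_idempotent => P [m [PP P0 Pm comP]].
set Q := Hadj H P.
have PN : P *m N = N *m P by rewrite comP.
(* By normality [P] commutes with the adjoint of [N]; taking adjoints, [Q] commutes with [N]. *)
have QN : Q *m N = N *m Q.
  by rewrite -[N](HadjK hH uH) /Q -!HadjM //; congr Hadj; rewrite comP.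
have PQ : P *m Q = Q *m P by rewrite comP.
have QQ : Q *m Q = Q by rewrite /Q -HadjM // PP.
have HQ : Hadj H Q = P by rewrite HadjK.
have [PQ0|PQ1] : P *m Q = 0 \/ P *m Q = 1%:M.
  apply: (indecomposable_idempotent uH indN).
  - by rewrite {2}PQ mulmxA -(mulmxA P) QQ -(mulmxA P) -PQ mulmxA PP.
  - by rewrite HadjM // HQ.
  - by rewrite -mulmxA QN !mulmxA PN.
- right; exists P, m.
  have PQ1 : P + Q = 1%:M.
    have [||||//] := @indecomposable_idempotent _ _ _ uH (P + Q) _ indN.
    + by rewrite mulmxDl !mulmxDr PP QQ -PQ PQ0 addr0 add0r.
    + by rewrite HadjD HQ addrC.
    + by rewrite mulmxDl mulmxDr PN QN.
    + by move/(congr1 (mulmx P)); rewrite mulmxDr PP PQ0 addr0 mulmx0 => /eqP; rewrite (negPf P0).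
  have Pk : (\rank P <= space_rank H)%N.
    apply: neutral_rank => //; rewrite -mulmxA -Hadj_form // mulmxA -/Q.
    by rewrite PQ0 mul0mx.
  have Qk : (\rank Q <= space_rank H)%N.
    apply: neutral_rank => //; rewrite -mulmxA -Hadj_form // mulmxA HQ.
    by rewrite -PQ PQ0 mul0mx.
  (* The chain 2k <= n <= rank P + rank Q <= 2k forces equality throughout. *)
  have := mxrank_add P Q; rewrite PQ1 mxrank1 => nPQ.
  have := space_rank_le hH uH => nk.
  by split=> //; lia.
- left; exists m; rewrite -horner_mx_XsubC_exp.
  have P1 : P = 1%:M by rewrite -PQ1 -{2}PP -mulmxA PQ1 mulmx1.
  by move: Pm; rewrite P1 mul1mx.
Qed.

Lemma eigenvalue_kernel l a m (P : 'M[C]_n.+1) (x : 'rV[C]_n.+1) :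
    P *m N = N *m P -> P *m horner_mx N (('X - l%:P) ^+ m) = 0 ->
    x *m N = a *: x -> a != l ->
  x *m P = 0.
Proof.
move=> PN Pm xN al; apply: (coprime_kernel (N := N) (f := 'X - a%:P) (g := ('X - l%:P) ^+ m)).
- by rewrite coprimep_expr // coprimep_XsubC root_XsubC eq_sym.
- rewrite rmorphB /= horner_mx_X horner_mx_C mulmxBr -mulmxA PN mulmxA xN.
  by rewrite -scalemxAl mul_mx_scalar subrr.
- by rewrite -mulmxA Pm mulmx0.
Qed.

Lemma indecomposable_bounds : (0 < space_rank H)%N ->
  (has_distinct_eigenvalues N 1 /\ (2 * space_rank H <= n.+1 <= 4 * space_rank H)%N) \/
  (has_distinct_eigenvalues N 2 /\ n.+1 = (2 * space_rank H)%N).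
Proof.
move=> k0; have nk := space_rank_le hH uH.
suff [[l [m Nm]]|[? ?]] : (exists l m, (N - l%:M) ^+ m = 0) \/
    (has_distinct_eigenvalues N 2 /\ n.+1 = (2 * space_rank H)%N).
- left; split; first exact: one_eigenvalue Nm.
  by rewrite nk (nilpotent_case k0 Nm).
- by right.
have [l Nl] := eigenvalue_closed N (ltn0Sn n).
have [/all_pred1P sE|] := boolP (all (pred1 l) (eigvals N)).
  left; exists l, (size (eigvals N)); rewrite -horner_mx_XsubC_exp.
  have : char_poly N = ('X - l%:P) ^+ size (eigvals N).
    by rewrite char_poly_eigvals {1}sE big_nseq iter_mulr_1.
  by move=> <-; exact: Cayley_Hamilton.
case/allPn => v; rewrite mem_eigvals => Nv /= vl.
have [[m Nm]|[P [m [PP rP Pm PN nE]]]] := eigenvalue_dichotomy Nl.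
  by left; exists l, m.
have [[m' Nm]|[Q [m' [QQ rQ Qm QN _]]]] := eigenvalue_dichotomy Nv.
  by left; exists v, m'.
right; split=> //.
have QP : Q *m P = 0.
  apply: (coprime_kernel (N := N) (f := ('X - v%:P) ^+ m') (g := ('X - l%:P) ^+ m)).
  - by rewrite coprimep_expr // coprimep_expl // coprimep_XsubC root_XsubC eq_sym.
  - have : comm_mx P (horner_mx N (('X - v%:P) ^+ m')) by exact: comm_mx_horner.
    by rewrite -mulmxA => ->; rewrite mulmxA Qm mul0mx.
  - by rewrite -mulmxA Pm mulmx0.
have PQ : P *m Q = 0.
  apply: (coprime_kernel (N := N) (f := ('X - v%:P) ^+ m') (g := ('X - l%:P) ^+ m)).
  - by rewrite coprimep_expr // coprimep_expl // coprimep_XsubC root_XsubC eq_sym.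
  - by rewrite -mulmxA Qm mulmx0.
  - have : comm_mx Q (horner_mx N (('X - l%:P) ^+ m)) by exact: comm_mx_horner.
    by rewrite -mulmxA => ->; rewrite mulmxA Pm mul0mx.
(* [P] and [Q] belong to the eigenvalues l and v. Their images are independent and each has
   dimension n/2, so [P + Q] is invertible; yet both kill an eigenvector for any third
   eigenvalue. *)
have uPQ : P + Q \in unitmx.
  set S := P + Q; rewrite -row_full_unit -sub1mx.
  have PS : (P <= S)%MS.
    by apply/submxP; exists P; rewrite mulmxDr PP PQ addr0.
  have QS : (Q <= S)%MS.
    by apply/submxP; exists Q; rewrite mulmxDr QQ QP add0r.
  have cap : (P :&: Q)%MS = 0.
    apply/eqP/rowV0P => x; rewrite sub_capmx => /andP[/submxP[y xE] /submxP[z zE]].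
    have xP : x *m P = x by rewrite xE -mulmxA PP.
    by rewrite -xP zE -mulmxA QP mulmx0.
  have PQS : (P + Q <= S)%MS by rewrite addsmx_sub PS QS.
  apply: submx_trans PQS; rewrite sub1mx /row_full mxrank_disjoint_sum // rP rQ.
  by apply/eqP; lia.
exists [:: l; v]; split=> //; first by rewrite /= inE eq_sym vl.
move=> a; rewrite !inE; apply/idP/idP => [/orP[/eqP ->|/eqP ->] //|].
case/eigenvalueP => x xN; apply: contraNT; rewrite negb_or => /andP[al av].
rewrite -(mulmxK uPQ x) mulmxDr (eigenvalue_kernel PN Pm xN al).
by rewrite (eigenvalue_kernel QN Qm xN av) addr0 mul0mx.
Qed.

End Bounds.

(** * Jordan blocks and the idempotents commuting with them *)

Section Jordan.
Variable R : nzRingType.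

Lemma sum_delta n (a : nat) (F : nat -> R) :
  \sum_(l < n) (a == l)%:R * F l = if (a < n)%N then F a else 0.
Proof.
case: ifP => [an|/negbT an].
  rewrite (bigD1 (Ordinal an)) //= eqxx mul1r big1 ?addr0 // => l.
  by rewrite -val_eqE /= eq_sym => /negPf ->; rewrite mul0r.
rewrite big1 // => l _; case: eqP => [al|_]; last by rewrite mul0r.
by rewrite al ltn_ord in an.
Qed.

Definition jordan_block n : 'M[R]_n := \matrix_(i, j) (i.+1 == j)%:R.

Lemma jordan_block_exp n m :
  jordan_block n ^+ m = \matrix_(i, j) ((i + m)%N == j)%:R.
Proof.
elim: m => [|m IHm]; apply/matrixP => i j.
  by rewrite expr0 !mxE addn0.
rewrite exprSr IHm !mxE.
rewrite (eq_bigr (fun l : 'I_n => ((i + m)%N == l)%:R * (l.+1 == j)%:R)); last first.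
  by move=> l _; rewrite !mxE.
rewrite (sum_delta n (i + m) (fun l => (l.+1 == j)%:R)) addnS.
by case: ifP => // im; case: eqP => // e; have := ltn_ord j; lia.
Qed.

Lemma jordan_block_nilpotent n : jordan_block n ^+ n = 0.
Proof.
rewrite jordan_block_exp; apply/matrixP => i j; rewrite !mxE.
by case: eqP => // e; have := ltn_ord j; lia.
Qed.

Lemma jordan_block_kernel n (y : 'rV[R]_n) (i : 'I_n) :
  y *m jordan_block n = 0 -> (i.+1 < n)%N -> y 0 i = 0.
Proof.
move=> yJ ni; have /rowP/(_ (Ordinal ni)) := yJ; rewrite !mxE => <-.
rewrite (bigD1 i) //= mxE eqxx mulr1 big1 ?addr0 // => l li.
by rewrite mxE /= eqSS (inj_eq val_inj) (negPf li) mulr0.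
Qed.

End Jordan.

(** For a nontrivial [E], the image and the kernel would be nonzero subspaces stable under the
    block, each containing a nonzero vector that the block kills. But the block kills only the line
    of the last basis vector. *)
Lemma jordan_block_commutant (F : fieldType) n (E : 'M[F]_n) :
  E *m E = E -> E *m jordan_block F n = jordan_block F n *m E ->
  E = 0 \/ E = 1%:M.
Proof.
set J := jordan_block F n.
have fixed_kernel (X : 'M[F]_n) : X *m X = X -> X *m J = J *m X -> X != 0 ->
    exists2 y : 'rV[F]_n, y *m X = y & y *m J = 0 /\ y != 0.
  move=> XX XJ X0; have X0' : ~~ (X <= (0 : 'M[F]_n))%MS by rewrite submx0.
  have [i [iX iXJ]] := nilpotent_mod (jordan_block_nilpotent F n) X0'.
  rewrite !submx0 in iX iXJ; move/rowV0Pn: iX => [y /submxP[u yE] y0].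
  exists y; last by split=> //; rewrite yE -mulmxA (eqP iXJ) mulmx0.
  have : GRing.comm X (J ^+ i) by apply: commrX; exact: XJ.
  rewrite /GRing.comm -!mulmxE => c.
  by rewrite yE -!mulmxA -c (mulmxA X) XX.
move=> EE EJ; have [->|E0] := eqVneq E 0; first by left.
have [->|E1] := eqVneq E 1%:M; first by right.
have [y yE [yJ y0]] := fixed_kernel E EE EJ E0.
have [||| z zE [zJ z0]] := fixed_kernel (1%:M - E).
- by rewrite mulmxBl mul1mx mulmxBr mulmx1 EE subrr subr0.
- by rewrite mulmxBl mulmxBr mul1mx mulmx1 EJ.
- by rewrite subr_eq0 eq_sym.
have {}zE : z *m E = 0 by rewrite -zE -mulmxA mulmxBl mul1mx EE subrr mulmx0.
have lastP (w : 'rV[F]_n) : w *m J = 0 -> w != 0 ->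
    exists i : 'I_n, i.+1 = n /\ w 0 i != 0.
  move=> wJ /rV0Pn[i wi]; exists i; split=> //; apply/eqP; move: (ltn_ord i).
  by rewrite leq_eqVlt => /orP[//|/(jordan_block_kernel wJ)/eqP]; rewrite (negPf wi).
have [i [iN yi]] := lastP y yJ y0; have [j [jN zj]] := lastP z zJ z0.
have ji : j = i by apply: val_inj => /=; lia.
(* Both vectors are multiples of the last basis vector; [E] fixes one and kills the other. *)
subst j; have : z 0 i *: y = y 0 i *: z.
  apply/rowP => l; rewrite !mxE; have [->|li] := eqVneq l i; first by rewrite mulrC.
  have ln : (l.+1 < n)%N by move: li (ltn_ord l); rewrite -val_eqE /=; lia.
  by rewrite !(jordan_block_kernel _ ln) ?mulr0.
move/(congr1 (mulmxr E)); rewrite /= -!scalemxAl yE zE scaler0 => /eqP.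
by rewrite scaler_eq0 (negPf zj) (negPf y0).
Qed.

(** * Operators attaining the bounds *)

Section Examples.
Variables (C : numClosedFieldType) (k : nat).
Hypothesis k0 : (0 < k)%N.

Lemma indecomposable_of_idempotents n (H N : 'M[C]_n) :
    H \is hermsymmx -> H \in unitmx ->
    (forall E, E *m E = E -> Hadj H E = E -> E *m N = N *m E ->
       E = 0 \/ E = 1%:M) ->
  indecomposable H N.
Proof.
move=> hH uH idem /(decomposable_idempotent hH uH)[E [EE EH EN E0 E1]].
by case: (idem E EE EH EN) => e; [rewrite e eqxx in E0|rewrite e eqxx in E1].
Qed.

Lemma Hnormal_of n (H N B : 'M[C]_n) :
  H \in unitmx -> B *m H = H *m N ^t* -> N *m B = B *m N -> Hnormal H N.
Proof.
by move=> uH BH NB; exists B => //; apply/(is_HadjointE _ _ uH); exact: Hadj_unique.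
Qed.

Lemma involution_unitmx n (H : 'M[C]_n) : H *m H = 1%:M -> H \in unitmx.
Proof. by case/mulmx1_unit. Qed.

(** A squeeze: rank V <= k <= n/2 <= rank V, with k the rank of the space. *)
Lemma neutral_half n (H : 'M[C]_n) m (V : 'M[C]_(m, n)) :
    H \is hermsymmx -> H \in unitmx -> V *m H *m V ^t* = 0 -> (n <= 2 * \rank V)%N ->
  space_rank H = \rank V.
Proof.
move=> hH uH VV nV; have := neutral_rank hH uH VV.
by have := space_rank_le hH uH; lia.
Qed.

Lemma example_2k_one : exists H N : 'M[C]_(2 * k),
  [/\ H \is hermsymmx, H \in unitmx & space_rank H = k] /\
  [/\ Hnormal H N, indecomposable H N & has_distinct_eigenvalues N 1].
Proof.
pose n := (2 * k)%N.
pose H : 'M[C]_n := \matrix_(i, j) ((i + j.+1)%N == n)%:R.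
pose N := jordan_block C n; exists H, N.
(* [sum_delta] wants the nonzero column given as a function of the row. *)
have hE i j : H i j = ((n - i.+1)%N == j)%:R.
  by rewrite mxE; congr (_%:R); have := ltn_ord i; have := ltn_ord j; lia.
have HC : H ^t* = H.
  by apply/matrixP => i j; rewrite !mxE rmorph_nat addnS addnC addnS.
have hH : H \is hermsymmx by apply/hermP.
have HM (M : 'M[C]_n) (F : nat -> nat -> C) : (forall i j, M i j = F i j) ->
    forall i j, (H *m M) i j = F (n - i.+1)%N j.
  move=> MF i j; rewrite mxE (eq_bigr (fun l : 'I_n => ((n - i.+1)%N == l)%:R * F l j)).
    by rewrite (sum_delta n _ (fun l => F l j)); case: ltnP => //; have := ltn_ord i; lia.
  by move=> l _; rewrite hE MF.
have uH : H \in unitmx.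
  apply: involution_unitmx; apply/matrixP => i j.
  rewrite (HM _ (fun a b => ((a + b.+1)%N == n)%:R)); last by move=> ? ?; rewrite mxE.
  by rewrite !mxE; congr (_%:R); rewrite -val_eqE /=; have := ltn_ord i; have := ltn_ord j; lia.
have NH : N *m H = H *m N ^t*.
  apply/matrixP => i j.
  rewrite (HM _ (fun a b => (b.+1 == a)%:R)); last first.
    by move=> a b; rewrite !mxE rmorph_nat.
  rewrite mxE (eq_bigr (fun l : 'I_n => (i.+1 == l)%:R * ((l + j.+1)%N == n)%:R)); last first.
    by move=> l _; rewrite !mxE.
  rewrite (sum_delta n _ (fun l => ((l + j.+1)%N == n)%:R)).
  have := ltn_ord i; have := ltn_ord j.
  case: ifP => ni jn jn'; last rewrite -[LHS]/(false%:R); congr (_%:R).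
    by lia.
  by lia.
(* The first k basis vectors span a neutral subspace: i + j + 1 < 2k whenever i, j < k. *)
have rV : \rank (pid_mx k : 'M[C]_(k, n)) = k by rewrite rank_pid_mx // /n; lia.
split; split=> //.
- rewrite (neutral_half (V := pid_mx k : 'M[C]_(k, n)) hH uH) ?rV //.
  apply/matrixP => i j; rewrite [RHS]mxE mxE.
  apply: big1 => l _; rewrite mxE.
  rewrite (eq_bigr (fun p : 'I_n => ((i : nat) == p)%:R * ((p + l.+1)%N == n)%:R)); last first.
    by move=> p _; rewrite !mxE ltn_ord andbT.
  rewrite (sum_delta n _ (fun p => ((p + l.+1)%N == n)%:R)) !mxE rmorph_nat.
  have := ltn_ord i; have := ltn_ord j; case: ifP => [_|_ _ _]; last by rewrite mul0r.
  move=> jk ik; case: eqP => e; last by rewrite mul0r.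
  by case: eqP => e'; rewrite /= ?mulr0 //; move: e; rewrite -e' /n; lia.
- exact: Hnormal_of uH NH _.
- by apply: indecomposable_of_idempotents => // E EE _; exact: jordan_block_commutant.
- apply: (@one_eigenvalue _ _ _ 0 n); first by rewrite /n; lia.
  by rewrite raddf0 subr0; exact: jordan_block_nilpotent.
Qed.

Lemma example_2k_two : exists H N : 'M[C]_(2 * k),
  [/\ H \is hermsymmx, H \in unitmx & space_rank H = k] /\
  [/\ Hnormal H N, indecomposable H N & has_distinct_eigenvalues N 2].
Proof.
rewrite mul2n -addnn; set J := jordan_block C k.
pose H : 'M[C]_(k + k) := block_mx 0 1%:M 1%:M 0.
pose N : 'M[C]_(k + k) := block_mx J 0 0 1%:M; exists H, N.
pose B : 'M[C]_(k + k) := block_mx 1%:M 0 0 (J ^t*).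
have simp := (mulmx0, mul0mx, mulmx1, mul1mx, addr0, add0r).
have hH : H \is hermsymmx.
  by apply/hermP; rewrite tr_block_mx map_block_mx !trmx0 !trmx1 !map_mx0 !map_mx1.
have uH : H \in unitmx.
  by apply: involution_unitmx; rewrite mulmx_block !simp -scalar_mx_block.
have rV : \rank (row_mx 1%:M 0 : 'M[C]_(k, k + k)) = k.
  by rewrite rank_row_mx0 mxrank1.
have JX m : J *m J ^+ m = J ^+ m *m J by rewrite -[LHS]exprS exprSr.
split; split=> //.
- rewrite (neutral_half (V := row_mx 1%:M 0 : 'M[C]_(k, k + k)) hH uH) ?rV //; last by lia.
  by rewrite mul_row_block !simp tr_row_mx map_col_mx mul_row_col trmx1 trmx0
    map_mx1 map_mx0 !simp.
- apply: (@Hnormal_of _ _ _ B) => //.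
    rewrite tr_block_mx map_block_mx !mulmx_block !trmx0 !trmx1 !map_mx0 !map_mx1.
    by rewrite !simp.
  by rewrite !mulmx_block !simp.
- apply: indecomposable_of_idempotents => // E EE EH.
  rewrite -[E]submxK; set e1 := ulsubmx E; set e2 := ursubmx E.
  set e3 := dlsubmx E; set e4 := drsubmx E.
  have EHE := Hadj_form uH E; move: EE EHE; rewrite EH -[E]submxK -/e1 -/e2 -/e3 -/e4.
  rewrite tr_block_mx map_block_mx !mulmx_block !simp.
  move=> /eq_block_mx[e11 _ _ _] /eq_block_mx[_ e14 _ _] /eq_block_mx[eJ e2J e3J _].
  (* An off-diagonal block intertwines [J] with 1, so multiplying it by any power of [J] leaves it
     unchanged, while [J ^+ k] is 0. *)
  have e20 : e2 = 0.
    have eX m : e2 = J ^+ m *m e2.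
      elim: m => [|m IHm]; first by rewrite expr0 mul1mx.
      by rewrite exprSr -mulmxE -mulmxA -e2J.
    by rewrite (eX k) jordan_block_nilpotent mul0mx.
  have e30 : e3 = 0.
    have eX m : e3 = e3 *m J ^+ m.
      elim: m => [|m IHm]; first by rewrite expr0 mulmx1.
      by rewrite exprS -mulmxE mulmxA e3J.
    by rewrite (eX k) jordan_block_nilpotent mulmx0.
  have e4E : e4 = e1 ^t* by rewrite e14 trmxCK.
  rewrite e4E e20 e30; move: e11; rewrite e20 mul0mx addr0 => e11.
  have [->|->] := jordan_block_commutant e11 eJ; [left|right].
    by rewrite trmx0 map_mx0 block_mx0.
  by rewrite trmx1 map_mx1 -scalar_mx_block.
- exists [:: 0; 1]; split=> //; first by rewrite /= inE eq_sym oner_eq0.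
  (* [J] kills the last basis vector; its copies in the two blocks are eigenvectors for 0 and 1. *)
  have ki : (k.-1 < k)%N by rewrite prednK.
  pose i := Ordinal ki; have d0 : delta_mx 0 i != 0 :> 'rV[C]_k.
    by apply/eqP => /rowP/(_ i)/eqP; rewrite !mxE !eqxx oner_eq0.
  move=> a; rewrite !inE; apply/idP/idP.
    case/orP => /eqP ->; apply/eigenvalueP.
      exists (row_mx (delta_mx 0 i) 0); last by rewrite row_mx_eq0 negb_and d0.
      rewrite mul_row_block !simp scale0r -rowE -[RHS]row_mx0; congr row_mx.
      by apply/rowP => j; rewrite !mxE /= prednK // eq_sym (ltn_eqF (ltn_ord j)).
    exists (row_mx 0 (delta_mx 0 i)); last by rewrite row_mx_eq0 negb_and d0 orbT.
    by rewrite mul_row_block !simp scale1r.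
  case/eigenvalueP => x; rewrite -[x]hsubmxK mul_row_block !simp scale_row_mx.
  case/eq_row_mx => xJ x1 x0; apply: contraNT x0; rewrite negb_or => /andP[a0 a1].
  have -> : rsubmx x = 0.
    apply/eqP; move/eqP: x1; rewrite -{1}[rsubmx x]scale1r -subr_eq0 -scalerBl scaler_eq0.
    by rewrite subr_eq0 eq_sym (negPf a1).
  have -> : lsubmx x = 0.
    apply/eqP; have := mul_eigenvectorX k xJ; rewrite jordan_block_nilpotent mulmx0.
    by move/esym/eqP; rewrite scaler_eq0 expf_eq0 (negPf a0) andbF.
  by rewrite row_mx0.
Qed.

(** N^2 and NB both send b to a, by [T] and by 1. Commuting with them makes the b-to-b corner of [E]
    an idempotent that commutes with [T], hence 0 or 1. A zero corner forces [E] to vanish; for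
    corner 1 this is applied to 1 - E. *)
Lemma block4_idempotent (T S : 'M[C]_k) (E : 'M[C]_((k + k) + (k + k)))
    (N := block_mx (block_mx 0 T 0 0) (block_mx S 0 0 1%:M) 0 0)
    (B := block_mx (block_mx 0 1%:M 0 0) (block_mx 0 0 0 (T ^t*)) 0
            (block_mx 0 (S ^t*) 0 0)) :
    (forall e : 'M[C]_k, e *m e = e -> e *m T = T *m e -> e = 0 \/ e = 1%:M) ->
    S \in unitmx -> T *m T ^t* + S *m S ^t* = 1%:M ->
    E *m E = E -> E *m N = N *m E -> E *m B = B *m E ->
  E = 0 \/ E = 1%:M.
Proof.
move=> irrT uS TS.
have simp := (mulmx0, mul0mx, mulmx1, mul1mx, addr0, add0r).
have NB : N *m B = block_mx 0 (block_mx 0 1%:M 0 0) 0 0.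
  by rewrite /N /B !mulmx_block !simp !add_block_mx !simp TS block_mx0.
have NN : N *m N = block_mx 0 (block_mx 0 T 0 0) 0 0.
  by rewrite /N !mulmx_block !simp ?add_block_mx ?simp ?block_mx0.
have corner0 (F : 'M[C]_((k + k) + (k + k))) : F *m F = F ->
    F *m N = N *m F -> F *m B = B *m F -> ulsubmx (ulsubmx F) = 0 -> F = 0.
  move=> FF FN FB F0.
  have FNB : F *m (N *m B) = N *m B *m F by rewrite mulmxA FN -!mulmxA FB.
  move: FF FN FB FNB; rewrite NB /N /B -[F]submxK.
  rewrite -[ulsubmx F]submxK -[ursubmx F]submxK -[dlsubmx F]submxK -[drsubmx F]submxK F0.
  set f12 := ursubmx (ulsubmx F); set f21 := dlsubmx (ulsubmx F).
  set f22 := drsubmx (ulsubmx F); set f13 := ulsubmx (ursubmx F).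
  set f14 := ursubmx (ursubmx F); set f23 := dlsubmx (ursubmx F).
  set f24 := drsubmx (ursubmx F); set f31 := ulsubmx (dlsubmx F).
  set f32 := ursubmx (dlsubmx F); set f41 := dlsubmx (dlsubmx F).
  set f42 := drsubmx (dlsubmx F); set f33 := ulsubmx (drsubmx F).
  set f34 := ursubmx (drsubmx F); set f43 := dlsubmx (drsubmx F).
  set f44 := drsubmx (drsubmx F).
  clearbody f12 f21 f22 f13 f14 f23 f24 f31 f32 f41 f42 f33 f34 f43 f44.
  rewrite !mulmx_block !simp !add_block_mx !simp => FF FN FB.
  rewrite -(block_mx0 C k k k k) => /eq_block_mx[].
  move=> /eq_block_mx[f410 f420 _ _] /eq_block_mx[f430 f440 _ f210] _.
  move=> /eq_block_mx[_ f310 _ _]; subst f41 f42 f43 f44 f21 f31.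
  move: FB => /eq_block_mx[/eq_block_mx[_ f220 _ _] /eq_block_mx[f230 _ _ _] _ _].
  subst f22 f23; move: FN; rewrite !simp => /eq_block_mx[].
  move=> /eq_block_mx[_ /esym Sf32 _ _] /eq_block_mx[/esym Sf33 _ _ _] _ _.
  have f320 : f32 = 0 by rewrite -[f32](mulKmx uS) Sf32 mulmx0.
  have f330 : f33 = 0 by rewrite -[f33](mulKmx uS) Sf33 mulmx0.
  (* What remains of [F] is strictly triangular in the order b, p, q, a; a nilpotent idempotent is
     0. *)
  subst f32 f33; move: FF; rewrite !simp => /eq_block_mx[].
  move=> /eq_block_mx[_ f120 _ _] /eq_block_mx[f130 f14E _ f24E] _.
  move=> /eq_block_mx[_ f34E _ _].
  by rewrite -f14E -f24E -f34E -f120 -f130 !simp !block_mx0.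
move=> EE EN EB.
have ENN : E *m (N *m N) = N *m N *m E by rewrite mulmxA EN -!mulmxA EN.
have ENB : E *m (N *m B) = N *m B *m E by rewrite mulmxA EN -!mulmxA EB.
set e := ulsubmx (ulsubmx E).
have [ee eT] : e *m e = e /\ e *m T = T *m e.
  move: EE ENN ENB; rewrite NN NB -[E]submxK.
  rewrite -[ulsubmx E]submxK -[ursubmx E]submxK -[dlsubmx E]submxK -[drsubmx E]submxK.
  rewrite -/e !mulmx_block !simp ?add_block_mx ?simp -(block_mx0 C k k k k).
  move=> /eq_block_mx[/eq_block_mx[ee _ _ _] _ _ _].
  move=> /eq_block_mx[_ /eq_block_mx[_ eT _ _] _ _].
  move=> /eq_block_mx[_ /eq_block_mx[_ e44 _ e21] _ /eq_block_mx[_ e31 _ e41]].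
  move: ee; rewrite e21 e31 e41 !simp => ee.
  by split; rewrite // eT e44.
have [e0|e1] := irrT e ee eT; first by left; exact: corner0.
right; apply/eqP; rewrite eq_sym -subr_eq0; apply/eqP; apply: corner0.
- by rewrite mulmxBl mul1mx mulmxBr mulmx1 EE subrr subr0.
- by rewrite mulmxBl mulmxBr mul1mx mulmx1 EN.
- by rewrite mulmxBl mulmxBr mul1mx mulmx1 EB.
- rewrite -[E]submxK -[ulsubmx E]submxK -/e e1 !scalar_mx_block.
  by rewrite !opp_block_mx !add_block_mx !block_mxKul subrr.
Qed.

Lemma example_4k_one : exists H N : 'M[C]_(4 * k),
  [/\ H \is hermsymmx, H \in unitmx & space_rank H = k] /\
  [/\ Hnormal H N, indecomposable H N & has_distinct_eigenvalues N 1].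
Proof.
have -> : (4 * k = (k + k) + (k + k))%N by lia.
(* [J *m J ^t*] is the identity with its last diagonal entry replaced by 0. Since (3/5)^2 + (4/5)^2
   = 1, T T* + S S* = 1 holds with 4/5 on the diagonal of [S] and 1 in its last entry. *)
pose J := jordan_block C k; pose T : 'M[C]_k := (3 / 5) *: J.
pose s (i : 'I_k) : C := if (i.+1 < k)%N then 4 / 5 else 1.
pose S : 'M[C]_k := diag_mx (\row_i s i).
pose N : 'M[C]_((k + k) + (k + k)) :=
  block_mx (block_mx 0 T 0 0) (block_mx S 0 0 1%:M) 0 0.
pose B : 'M[C]_((k + k) + (k + k)) :=
  block_mx (block_mx 0 1%:M 0 0) (block_mx 0 0 0 (T ^t*)) 0
    (block_mx 0 (S ^t*) 0 0).
(* [H] pairs b with a and is the identity on p and q: k negative and 3k positive eigenvalues. *)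
pose H : 'M[C]_((k + k) + (k + k)) :=
  block_mx (block_mx 0 0 0 1%:M) (block_mx 0 1%:M 0 0)
    (block_mx 0 0 1%:M 0) (block_mx 1%:M 0 0 0).
have simp := (mulmx0, mul0mx, mulmx1, mul1mx, addr0, add0r).
have ctr_block p q r t (M1 : 'M[C]_(p, q)) (M2 : 'M_(p, r)) (M3 : 'M_(t, q)) M4 :
    (block_mx M1 M2 M3 M4) ^t* =
    block_mx (M1 ^t*) (M3 ^t*) (M2 ^t*) (M4 ^t*).
  by rewrite tr_block_mx map_block_mx.
have ctr_row p q r (M1 : 'M[C]_(p, q)) (M2 : 'M_(p, r)) :
    (row_mx M1 M2) ^t* = col_mx (M1 ^t*) (M2 ^t*).
  by rewrite tr_row_mx map_col_mx.
have ctr0 p q : (0 : 'M[C]_(p, q)) ^t* = 0 by rewrite trmx0 map_mx0.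
have ctr1 : (1%:M : 'M[C]_k) ^t* = 1%:M by rewrite trmx1 map_mx1.
have hH : H \is hermsymmx by apply/hermP; rewrite !ctr_block !ctr0 !ctr1.
have uH : H \in unitmx.
  apply: involution_unitmx; rewrite mulmx_block !mulmx_block !simp.
  by rewrite !add_block_mx !simp block_mx0 -!scalar_mx_block.
have BH : B *m H = H *m N ^t*.
  rewrite !ctr_block !ctr0 !ctr1 !mulmx_block !simp !add_block_mx !simp.
  by rewrite !block_mx0.
have s_real i : (s i)^* = s i.
  by rewrite /s; case: ifP; rewrite ?rmorph1 // rmorphM fmorphV !rmorph_nat.
have n5 : (5 : C) != 0 by rewrite pnatr_eq0.
have TS : T *m T ^t* + S *m S ^t* = 1%:M.
  apply/matrixP => i j; rewrite /S mul_diag_mx !mxE.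
  rewrite (eq_bigr (fun l : 'I_k =>
      (i.+1 == l)%:R * ((3 / 5) ^+ 2 * (j.+1 == l)%:R))); last first.
    move=> l _; rewrite !mxE rmorphM rmorph_nat rmorphM fmorphV !rmorph_nat.
    by field.
  rewrite (sum_delta k i.+1 (fun l => (3 / 5) ^+ 2 * (j.+1 == l)%:R)).
  rewrite rmorphMn /= s_real eqSS -!val_eqE /= (eq_sym (j : nat) i) /s.
  have [->|_] := eqVneq (i : nat) j; last by rewrite !mulr0n !mulr0 addr0; case: ifP.
  case: ifP => _; rewrite !mulr1n ?add0r ?mulr1 //.
  by field.
have uS : S \in unitmx.
  rewrite unitmxE det_diag unitfE; apply/prodf_neq0 => i _; rewrite mxE /s.
  by case: ifP; rewrite ?oner_eq0 // mulf_neq0 // ?invr_eq0 pnatr_eq0.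
have irrT (e : 'M[C]_k) : e *m e = e -> e *m T = T *m e -> e = 0 \/ e = 1%:M.
  move=> ee eT; apply: jordan_block_commutant => //.
  have c0 : (3 / 5 : C) != 0 by rewrite mulf_neq0 // ?invr_eq0 pnatr_eq0.
  by apply: (scalerI c0); rewrite scalemxAr eT scalemxAl.
have NB : N *m B = B *m N.
  by rewrite /N /B !mulmx_block !simp !add_block_mx !simp TS !block_mx0.
exists H, N; split; split=> //.
- apply/eqP; rewrite eqn_leq; apply/andP; split.
    (* The coordinates p, q, a span a positive semidefinite subspace of dimension 3k, leaving at
       most k negative eigenvalues. *)
    pose W : 'M[C]_((k + k) + (k + k)) := block_mx (block_mx 0 0 0 1%:M) 0 0 1%:M.
    have rW : \rank W = (k + (k + k))%N.
      by rewrite !rank_diag_block_mx mxrank0 !mxrank1.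
    rewrite /space_rank geq_min -(leq_add2l (k + (k + k))) -{1}rW.
    rewrite [X in (_ <= X)%N || _](_ : _ = (k + k) + (k + k))%N; last by lia.
    apply/orP; left; apply: semidefinite_pos_bound => // x /submxP[y ->].
    pose p := rsubmx (lsubmx y); pose q := lsubmx (rsubmx y).
    have -> : y *m W = row_mx (row_mx 0 p) (row_mx q (rsubmx (rsubmx y))).
      rewrite /W -{1}[y]hsubmxK -{1}[lsubmx y]hsubmxK !mul_row_block !simp.
      by rewrite /q hsubmxK.
    rewrite !ctr_row ctr0 !mul_row_block !simp !add_row_mx !simp !mul_row_col !simp.
    by rewrite mxE addr_ge0 // mxE sumr_ge0 // => l _; rewrite !mxE mul_conjC_ge0.
  (* The coordinates a span a neutral subspace of dimension k, which gives the lower bound. *)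
  pose V : 'M[C]_(k, (k + k) + (k + k)) := row_mx 0 (row_mx 0 1%:M).
  have rV : \rank V = k by rewrite !rank_row_0mx mxrank1.
  rewrite -[X in (X <= _)%N]rV; apply: neutral_rank => //.
  by rewrite !ctr_row !ctr0 !mul_row_block !simp !mul_row_col !simp.
- exact: Hnormal_of uH BH NB.
- apply: indecomposable_of_idempotents => // E EE EH EN.
  apply: (block4_idempotent irrT uS TS EE EN).
  by rewrite -/B (Hadj_unique uH BH) -EH -!HadjM // EN.
- apply: (@one_eigenvalue _ _ _ 0 3); first by lia.
  rewrite raddf0 subr0 !exprS expr0 -mulmxE mulmx1.
  have -> : N *m N = block_mx 0 (block_mx 0 T 0 0) 0 0.
    by rewrite /N !mulmx_block !simp ?add_block_mx ?simp ?block_mx0.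
  by rewrite /N !mulmx_block !simp ?add_block_mx ?simp ?block_mx0.
Qed.
End Examples.

Theorem theorem1 (R : realType) (k : nat) (hk : (0 < k)%N) :
  (forall (n : nat) (H N : 'M[R[i]]_n),
      H \is hermsymmx -> H \in unitmx -> space_rank H = k ->
      Hnormal H N -> indecomposable H N ->
      (has_distinct_eigenvalues N 1 /\ (2 * k <= n <= 4 * k)%N) \/
      (has_distinct_eigenvalues N 2 /\ n = (2 * k)%N)) /\
  (exists H N : 'M[R[i]]_(2 * k),
      [/\ H \is hermsymmx, H \in unitmx & space_rank H = k] /\
      [/\ Hnormal H N, indecomposable H N & has_distinct_eigenvalues N 1]) /\
  (exists H N : 'M[R[i]]_(4 * k),
      [/\ H \is hermsymmx, H \in unitmx & space_rank H = k] /\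
      [/\ Hnormal H N, indecomposable H N & has_distinct_eigenvalues N 1]) /\
  (exists H N : 'M[R[i]]_(2 * k),
      [/\ H \is hermsymmx, H \in unitmx & space_rank H = k] /\
      [/\ Hnormal H N, indecomposable H N & has_distinct_eigenvalues N 2]).
Proof.
split; last first.
  by split; [|split]; [exact: example_2k_one|exact: example_4k_one|exact: example_2k_two].
move=> n H N hH uH Hk [B /(is_HadjointE _ _ uH) BE NB] indN; rewrite -Hk in hk *.
(* Dimension 0 has rank 0, against [hk]; evaluating polynomials at matrices asks for a size of the
   form [n.+1]. *)
case: n => [|n] in H N hH uH Hk B BE NB indN hk *.
  by have := space_rank_le hH uH; rewrite leqn0 muln_eq0 /= => /eqP rk; rewrite rk in hk.
by apply: indecomposable_bounds => //; rewrite -[Hadj H N]BE.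
Qed.
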